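(* Let $(S_1,S_2)$ be an Euler pair. Then for every $n\geqslant 0$, $$q_e(S_2;n)-q_o(S_2;n)=p_e(S_1;n)-p_o(S_1;n).$$
   Context: For a set $S$ of positive integers, $p(S;n)$ is the number of partitions of $n$ with all parts in $S$, and $q(S;n)$ is the number of partitions of $n$ into distinct parts, all in $S$. $p_e(S;n)$ (resp. $p_o(S;n)$) is the number of partitions of $n$ with parts in $S$ having an even (resp. odd) number of parts; $q_e(S;n)$ (resp. $q_o(S;n)$) is the number of partitions of $n$ into distinct parts in $S$ having an even (resp. odd) number of parts. A pair $(S_1,S_2)$ of subsets of the positive integers is an Euler pair if $q(S_1;n)=p(S_2;n)$ for all $n\geqslant 0$. *)

(* Defs.v *)
From mathcomp Require Import all_boot all_order all_algebra finmap.
From mathcomp Require Import boolp classical_sets functions cardinality.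

Set Implicit Arguments.
Unset Strict Implicit.
Unset Printing Implicit Defensive.

Local Open Scope classical_set_scope.

(* A partition is the weakly decreasing list of its parts;
   the empty list is the unique partition of 0. *)
Definition is_partition (n : nat) (s : seq nat) : Prop :=
  [/\ sorted geq s, all (leq 1) s & sumn s = n].

Definition partitions (S : set nat) (n : nat) : set (seq nat) :=
  [set s | is_partition n s /\ forall k, k \in s -> S k].

Definition distinct_partitions (S : set nat) (n : nat) : set (seq nat) :=
  [set s | partitions S n s /\ uniq s].

Definition even_length : set (seq nat) := [set s | ~~ odd (size s)].

Definition odd_length : set (seq nat) := [set s | odd (size s)].

(* [fset_set] is empty on infinite sets; [finite_partitions] and
   [finite_distinct_partitions] below rule this case out. *)
Definition card (A : set (seq nat)) : nat := #|` fset_set A|.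

Definition p (S : set nat) (n : nat) : nat := card (partitions S n).

Definition q (S : set nat) (n : nat) : nat := card (distinct_partitions S n).

Definition p_e (S : set nat) (n : nat) : nat :=
  card (partitions S n `&` even_length).

Definition p_o (S : set nat) (n : nat) : nat :=
  card (partitions S n `&` odd_length).

Definition q_e (S : set nat) (n : nat) : nat :=
  card (distinct_partitions S n `&` even_length).

Definition q_o (S : set nat) (n : nat) : nat :=
  card (distinct_partitions S n `&` odd_length).

Definition Euler_pair (S1 S2 : set nat) : Prop :=
  [/\ S1 `<=` [set k | 0 < k], S2 `<=` [set k | 0 < k]
    & forall n, q S1 n = p S2 n].

Lemma finite_partitions (S : set nat) (n : nat) : finite_set (partitions S n).
Proof.
pose f (t : {bseq n of 'I_n.+1}) : seq nat := map val (t : seq 'I_n.+1).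
apply: (@sub_finite_set _ _ [set f t | t in [set: {bseq n of 'I_n.+1}]]);
  last by apply: finite_image; exact: finite_finset.
move=> s [[_ s_gt0 s_n] _].
have size_s : size s <= n.
  rewrite -s_n; elim: s s_gt0 {s_n} => //= k s IHs /andP[k_gt0 s_gt0].
  by rewrite -add1n leq_add ?IHs.
have part_s k : k \in s -> k < n.+1.
  move=> ks; rewrite ltnS -s_n; elim: s ks {s_gt0 s_n size_s} => //= j s IHs.
  rewrite inE => /orP[/eqP->|/IHs ks]; first exact: leq_addr.
  exact: leq_trans ks (leq_addl _ _).
have size_t : size [seq inord k : 'I_n.+1 | k <- s] <= n by rewrite size_map.
exists (Bseq size_t) => //; rewrite /f /= -map_comp.
by apply: map_id_in => k /part_s; exact: inordK.
Qed.

Lemma finite_distinct_partitions (S : set nat) (n : nat) :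
  finite_set (distinct_partitions S n).
Proof. by apply: sub_finite_set (finite_partitions S n) => s []. Qed.

(* Main.v *)
(** Writing [d_q(S; n)] and [d_p(S; n)] for the even-minus-odd counts, both
    [sum_i p(S; i) d_q(S; n - i)] and [sum_i d_p(S; i) q(S; n - i)] vanish for
    [n > 0]: on pairs formed by a partition and a distinct partition, moving
    the largest part from one component to the other is an involution that
    changes the parity of both lengths.  For an Euler pair, [d_q(S2; _)] and
    [d_p(S1; _)] are thus convolution inverses of the same sequence
    [p(S2; _) = q(S1; _)], and therefore agree. *)
Require Import Defs.
From mathcomp Require Import all_boot all_order all_algebra finmap.
From mathcomp Require Import boolp classical_sets functions cardinality.
From mathcomp Require Import zify.

Import GRing.Theory.

Local Open Scope ring_scope.

(** Reindexing along [f], which permutes [L], shows that the sum equals its own negative; over the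
    integers this forces it to be zero. Fixed points are harmless, as their weight vanishes for the
    same reason. *)
Lemma sumr_signed_involution (T : eqType) (L : seq T) (f : T -> T)
    (w : T -> int) :
  uniq L -> {in L, forall x, f x \in L} -> {in L, cancel f f} ->
  {in L, forall x, w (f x) = - w x} -> \sum_(x <- L) w x = 0.
Proof.
move=> uL fL fK wf.
have permL : perm_eq L (map f L).
  apply: uniq_perm => //.
    by rewrite map_inj_in_uniq //; apply: can_in_inj fK.
  move=> x; apply/idP/mapP => [xL|[y yL ->]]; last exact: fL.
  by exists (f x); rewrite ?fK ?fL.
have : \sum_(x <- L) w x = - \sum_(x <- L) w x.
  rewrite {1}(perm_big _ permL) /= big_map -sumrN.
  by rewrite big_seq [RHS]big_seq; apply: eq_bigr => x /wf.
lia.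
Qed.

(** Strong induction: since [a 0] is 1, the term of index 0 isolates [b n] and [c n], and all other
    terms only involve smaller indices. *)
Lemma convolution_cancel (a b c : nat -> int) :
  a 0%N = 1 ->
  (forall n, \sum_(i < n.+1) a i * b (n - i)%N
           = \sum_(i < n.+1) a i * c (n - i)%N) ->
  b =1 c.
Proof.
move=> a0 Habc n; elim/ltn_ind: n => n IHn.
have := Habc n; rewrite !big_ord_recl /= a0 !mul1r subn0.
rewrite (eq_bigr (fun i : 'I_n => a (bump 0 i) * c (n - bump 0 i)%N)).
  exact: addIr.
by move=> i _; rewrite IHn // /bump /=; have := ltn_ord i; lia.
Qed.

Lemma card_setI_pred (A : set (seq nat)) (b : pred (seq nat)) :
  finite_set A ->
  Defs.card (A `&` [set s | b s])%classic = count b (fset_set A).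
Proof.
move=> finA.
have finAb : finite_set (A `&` [set s | b s])%classic by exact: finite_setIl.
rewrite /Defs.card -size_filter; apply: perm_size; apply: uniq_perm.
- exact: fset_uniq.
- by apply: filter_uniq; exact: fset_uniq.
move=> s; rewrite in_fset_set // mem_filter in_fset_set // in_setI andbC.
by congr (_ && _); apply/idP/idP; rewrite inE.
Qed.

Lemma even_minus_odd_card (A : set (seq nat)) :
  finite_set A ->
  (Defs.card (A `&` even_length)%classic)%:Z
  - (Defs.card (A `&` odd_length)%classic)%:Z
  = \sum_(s <- fset_set A) (-1) ^+ size s.
Proof.
move=> finA; rewrite (card_setI_pred _ (fun s => ~~ odd (size s))) //.
rewrite (card_setI_pred _ (fun s => odd (size s))) //.
elim: (enum_fset _) => [|s l IHl]; first by rewrite big_nil.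
rewrite big_cons -IHl /= -signr_odd.
by case: (odd (size s)) => /=; lia.
Qed.

Lemma card_sum1 (A : set (seq nat)) :
  (Defs.card A)%:Z = \sum_(s <- fset_set A) 1.
Proof. by rewrite big_const_seq count_predT iter_addr_0 /Defs.card natz. Qed.

Lemma partitions0 (S : set nat) (s : seq nat) : partitions S 0 s <-> s = [::].
Proof.
split=> [[[_ s_gt0 s_sum] _]|->]; last by [].
by case: s s_gt0 s_sum => //= k s /andP[k_gt0 _]; lia.
Qed.

Lemma fset_set_partitions0 (S : set nat) :
  fset_set (partitions S 0) = [fset [::]]%fset.
Proof.
rewrite -fset_set1; congr fset_set; apply/seteqP.
by split=> s /partitions0.
Qed.

Lemma fset_set_distinct_partitions0 (S : set nat) :
  fset_set (distinct_partitions S 0) = [fset [::]]%fset.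
Proof.
rewrite -fset_set1; congr fset_set; apply/seteqP.
by split=> s => [[/partitions0]//|->]; split=> //; apply/partitions0.
Qed.

(** The default 0 of [head] makes the comparison with an empty tail automatic. In the distinct
    version below, its strict form amounts there to [0 < k]. *)
Lemma partitions_cons (S : set nat) (n k : nat) (s : seq nat) :
  partitions S n (k :: s) <->
  [/\ (0 < k)%N, S k, (head 0 s <= k)%N, (k <= n)%N & partitions S (n - k) s].
Proof.
have pathE : path geq k s = (head 0 s <= k)%N && sorted geq s by case: s.
split.
  move=> [[/= srt /andP[k0 pos] sm] inS]; move: srt; rewrite pathE.
  move=> /andP[hs srt]; split=> //; [|lia|].
  - by apply: inS; rewrite inE eqxx.
  - by split=> [|j js]; [split=> //; lia|apply: inS; rewrite inE js orbT].
move=> [k0 Sk hs kn [[srt pos sm] inS]]; split.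
  by split; rewrite /= ?pathE ?hs ?k0 //; lia.
by move=> j; rewrite inE => /orP[/eqP->|/inS].
Qed.

Lemma distinct_partitions_cons (S : set nat) (n k : nat) (s : seq nat) :
  distinct_partitions S n (k :: s) <->
  [/\ (0 < k)%N, S k, (head 0 s < k)%N, (k <= n)%N
    & distinct_partitions S (n - k) s].
Proof.
split.
  move=> [/partitions_cons[k0 Sk hs kn ps] /= /andP[ks us]]; split=> //.
  case: s hs ps ks us => //= j s jk _; rewrite inE negb_or; lia.
move=> [k0 Sk hs kn [ps us]]; split.
  by apply/partitions_cons; split=> //; exact: ltnW.
rewrite /= us andbT; case: ps => -[srt _ _] _; apply/negP => ks.
(* The head of a weakly decreasing list bounds every entry, so a [k] above the head cannot occur in
   [s]. *)
have : all (geq (head 0%N s)) s.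
  case: s srt {us hs ks} => //= j s; rewrite leqnn /=.
  by apply: order_path_min => x y z /= yx zx; exact: leq_trans zx yx.
by move=> /allP/(_ _ ks) /=; rewrite leqNgt hs.
Qed.

(* On equal heads the part of the second, distinct, component is moved: the
   remaining heads then determine which component it came from. *)
Definition move_largest (x : seq nat * seq nat) : seq nat * seq nat :=
  let: (s, t) := x in
  if (head 0 s <= head 0 t)%N then (head 0%N t :: s, behead t)
  else (behead s, head 0%N s :: t).

Definition partition_pair (S : set nat) (n : nat) (x : seq nat * seq nat) :=
  [/\ partitions S (sumn x.1) x.1, distinct_partitions S (sumn x.2) x.2
    & (sumn x.1 + sumn x.2)%N = n].

(** After [k] leaves [t], distinctness puts the new head of [t] strictly below [k], so the next move
    goes back. After [k] leaves [s], the new head of [s] is at most [k], and the weak test again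
    selects the return move. *)
Lemma move_largest_spec (S : set nat) (n : nat) (x : seq nat * seq nat) :
  (0 < n)%N -> partition_pair S n x ->
  [/\ partition_pair S n (move_largest x), move_largest (move_largest x) = x,
      odd (size (move_largest x).1) = ~~ odd (size x.1)
    & odd (size (move_largest x).2) = ~~ odd (size x.2)].
Proof.
case: x => s t n_gt0 [/= ps qt sm]; rewrite /move_largest.
case: leqP => [st|ts].
- case: t qt sm st => [|k t] qt sm /= st.
    (* An empty [t] has default head 0: then [s] is either empty, against [0 < n], or starts with a
       part 0. *)
    case: s ps sm st => [|j s] ps /= sm jle0; first lia.
    by case/partitions_cons: ps; lia.
  case/distinct_partitions_cons: qt => k0 Sk tk _.
  rewrite /= addKn => qt; rewrite leqNgt tk /= negbK; split=> //.
  split=> //=; last by rewrite -sm /=; lia.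
  by apply/partitions_cons; rewrite addKn; split=> //; exact: leq_addr.
- case: s ps sm ts => [|k s] ps sm //= tk.
  case/partitions_cons: ps => k0 Sk sk _.
  rewrite /= addKn => ps; rewrite sk /= negbK; split=> //.
  split=> //=; last by rewrite -sm /=; lia.
  by apply/distinct_partitions_cons; rewrite addKn; split=> //; exact: leq_addr.
Qed.

(** The weight is kept abstract so that the sign may come from the length of either component. *)
Lemma sum_partition_pairs (S : set nat) (n : nat)
    (w : seq nat -> seq nat -> int) :
  (0 < n)%N ->
  (forall x, partition_pair S n x ->
     w (move_largest x).1 (move_largest x).2 = - w x.1 x.2) ->
  \sum_(i < n.+1) \sum_(s <- fset_set (partitions S i))
    \sum_(t <- fset_set (distinct_partitions S (n - i))) w s t = 0.
Proof.
move=> n_gt0 w_move.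
pose P i : seq (seq nat) := fset_set (partitions S i).
pose Q i : seq (seq nat) := fset_set (distinct_partitions S i).
have inP i s : (s \in P i) <-> partitions S i s.
  by rewrite in_fset_set ?inE//; exact: finite_partitions.
have inQ i s : (s \in Q i) <-> distinct_partitions S i s.
  by rewrite in_fset_set ?inE//; exact: finite_distinct_partitions.
have sumP i s : s \in P i -> sumn s = i by move=> /inP[[]].
have sumQ i s : s \in Q i -> sumn s = i by move=> /inQ[[[]]].
pose L := [seq x | i <- iota 0 n.+1,
                   x <- [seq (s, t) | s <- P i, t <- Q (n - i)%N]].
have inL x : (x \in L) <-> partition_pair S n x.
  split.
    move=> /allpairsPdep[i [y [+ + ->]]]; rewrite mem_iota => /andP[_ lein].
    move=> /allpairsP[[s t] /= [sP tQ ->]]; split=> /=.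
    + by rewrite (sumP _ _ sP); apply/inP.
    + by rewrite (sumQ _ _ tQ); apply/inQ.
    + by rewrite (sumP _ _ sP) (sumQ _ _ tQ); lia.
  case: x => s t [/= ps qt sm]; apply/allpairsPdep; exists (sumn s), (s, t).
  split=> //; first by rewrite mem_iota; lia.
  apply: allpairs_f; first exact/inP.
  by apply/inQ; rewrite -sm addKn.
have uL : uniq L.
  apply: allpairs_uniq_dep; first exact: iota_uniq.
  - move=> i _; apply: allpairs_uniq; [exact: fset_uniq|exact: fset_uniq|].
    by move=> [? ?] [? ?].
  (* The blocks of [L] are disjoint because a pair determines its index [i] as the sum of its first
     component. *)
  move=> _ _ /allpairsPdep[i [x [_ + ->]]] /allpairsPdep[j [y [_ + ->]]] /=.
  move=> /allpairsP[u [/sumP ui _ xE]] /allpairsP[v [/sumP vj _ yE]] xy.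
  have ij : i = j by move: xy; rewrite -ui -vj xE yE => -[->].
  by rewrite ij xy.
transitivity (\sum_(x <- L) w x.1 x.2).
  rewrite big_allpairs_dep /= -(big_mkord xpredT (fun i => \sum_(s <- P i)
    \sum_(t <- Q (n - i)%N) w s t)) /index_iota subn0.
  by apply: eq_bigr => i _; rewrite big_allpairs.
apply: (@sumr_signed_involution _ L move_largest) => // x /inL xX.
- by apply/inL; case: (move_largest_spec _ _ _ n_gt0 xX).
- by case: (move_largest_spec _ _ _ n_gt0 xX).
- exact: w_move.
Qed.

(** Coefficientwise, the product over [k] in [S] of 1/(1 - x^k) times that of (1 - x^k) is 1. *)
Lemma convolution_p_dq (S : set nat) (n : nat) :
  \sum_(i < n.+1) (p S i)%:Z * ((q_e S (n - i))%:Z - (q_o S (n - i))%:Z)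
  = (n == 0%N)%:R.
Proof.
under eq_bigr => i _ do rewrite /p /q_e /q_o
  (even_minus_odd_card _ (finite_distinct_partitions _ _)) card_sum1
  big_distrl /=.
(* In degree 0 the only pair consists of two empty lists, which [move_largest] cannot handle; it
   contributes 1. *)
case: n => [|n].
  by rewrite big_ord1 fset_set_partitions0 fset_set_distinct_partitions0
    !big_seq_fset1.
under eq_bigr => i _ do under eq_bigr => s _ do rewrite big_distrr /=.
apply: (sum_partition_pairs _ _ (fun s t => 1 * (-1) ^+ size t)) => // x xX.
have [_ _ _ szE] := move_largest_spec _ _ _ (ltn0Sn n) xX.
by rewrite -signr_odd szE signrN signr_odd mulrN.
Qed.

(** The companion identity, with 1/(1 + x^k) and (1 + x^k). *)
Lemma convolution_dp_q (S : set nat) (n : nat) :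
  \sum_(i < n.+1) ((p_e S i)%:Z - (p_o S i)%:Z) * (q S (n - i))%:Z
  = (n == 0%N)%:R.
Proof.
under eq_bigr => i _ do rewrite /q /p_e /p_o
  (even_minus_odd_card _ (finite_partitions _ _)) card_sum1
  big_distrl /=.
case: n => [|n].
  by rewrite big_ord1 fset_set_partitions0 fset_set_distinct_partitions0
    !big_seq_fset1.
under eq_bigr => i _ do under eq_bigr => s _ do rewrite big_distrr /=.
apply: (sum_partition_pairs _ _ (fun s t => (-1) ^+ size s * 1)) => // x xX.
have [_ _ szE _] := move_largest_spec _ _ _ (ltn0Sn n) xX.
by rewrite -signr_odd szE signrN signr_odd mulNr.
Qed.

Theorem theorem3p2 (S1 S2 : set nat) (hE : Euler_pair S1 S2) (n : nat) :
  (q_e S2 n)%:Z - (q_o S2 n)%:Z = (p_e S1 n)%:Z - (p_o S1 n)%:Z.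
Proof.
case: hE => _ _ pq.
apply: (convolution_cancel (fun i => (p S2 i)%:Z)
  (fun i => (q_e S2 i)%:Z - (q_o S2 i)%:Z)
  (fun i => (p_e S1 i)%:Z - (p_o S1 i)%:Z)) => [|m].
  by rewrite /p card_sum1 fset_set_partitions0 big_seq_fset1.
(* Both convolutions equal the unit sequence; reversing the index puts the factor [q S1 i] opposite
   [p S2 i], and these agree for an Euler pair. *)
rewrite convolution_p_dq -(convolution_dp_q S1) (reindex_inj rev_ord_inj) /=.
apply: eq_bigr => i _.
by rewrite subSS mulrC pq subKn // -ltnS.
Qed.
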